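(* Let $d\ge2$, $0\le m\le d$, and let $a_1,\dots,a_d,b_1,\dots,b_d$ be complex numbers which are pairwise distinct modulo $\pi$. Let $J\subset\{1,\dots,d\}$ be a subset with $m$ elements. Then $$\sum_{I}\frac{\prod_{i\in I,\,j'\in J'}\sin(a_i-b_{j'})\ \prod_{i'\in I',\,j\in J}\sin(b_j-a_{i'})}{\prod_{i\in I,\,i'\in I'}\sin(a_i-a_{i'})\ \prod_{j\in J,\,j'\in J'}\sin(b_j-b_{j'})}=1,$$ where the sum is taken over all subsets $I\subset\{1,\dots,d\}$ with $m$ elements, and $I',J'$ denote the complements of $I,J$ in $\{1,\dots,d\}$.
   Context: Empty products are equal to $1$. *)

(* Defs.v *)
(* MathComp / MathComp-Analysis; complex numbers are R[i] with R : realType *)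
From mathcomp Require Import all_boot all_order all_algebra.
From mathcomp Require Import reals sequences exp trigo.
From mathcomp Require Import complex.

Set Implicit Arguments.
Unset Strict Implicit.
Unset Printing Implicit Defensive.

Import Order.TTheory GRing.Theory Num.Theory.
Local Open Scope ring_scope.
Local Open Scope complex_scope.

(* exp (x + iy) = e^x (cos y + i sin y) *)
Definition cexp (R : realType) (z : R[i]) : R[i] :=
  (expR (complex.Re z))%:C * (cos (complex.Im z) +i* sin (complex.Im z)).

(* The imaginary unit is written 0 +i* 1 because 'i may be parsed as
   Num.imaginary, which is not defined as this particular root of -1. *)
Definition csin (R : realType) (z : R[i]) : R[i] :=
  (cexp ((0 +i* 1) * z) - cexp (- ((0 +i* 1) * z))) / (2 * (0 +i* 1)).

Definition eq_mod_pi (R : realType) (x y : R[i]) : Prop :=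
  exists k : int, x - y = k%:~R * (pi : R)%:C.

(* The 2d numbers a_1, ..., a_d, b_1, ..., b_d as a single family, so that
   pairwise distinctness also compares the a_i with the b_j. *)
Definition joint_family (T : Type) (d : nat) (a b : 'I_d -> T)
    (s : 'I_d + 'I_d) : T :=
  match s with inl i => a i | inr j => b j end.

Definition pairwise_distinct_mod_pi (R : realType) (S : Type) (c : S -> R[i])
    : Prop :=
  forall s t : S, s <> t -> ~ eq_mod_pi (c s) (c t).

(* Main.v *)
Require Import Defs.
From mathcomp Require Import all_boot all_order all_algebra.
From mathcomp Require Import reals sequences exp trigo complex.
From mathcomp Require Import ring lra.
Import Order.TTheory GRing.Theory Num.Theory.
Local Open Scope ring_scope.
Local Open Scope complex_scope.

(** Writing e(z) = exp(iz), one has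
    sin(x - y) = (e(x)^2 - e(y)^2) / (2i e(x) e(y)).
    In each summand the monomial prefactors 1 / (2i e(x) e(y)) of the numerator
    and of the denominator multiply up to the same number, because I and J have
    the same cardinality: each a_i with i in I occurs d - m times in both, each
    a_i' with i' in I' occurs m times in both, and likewise for the b_j.  Hence
    the identity is equivalent to the rational one for X_i = e(a_i)^2 and
    Y_j = e(b_j)^2, in which every sine of a difference is replaced by the
    difference itself [prod_cross_scale, csin_sub].

    The rational identity [sum_subsets_cross_prod] holds over any field, for
    distinct X_i and arbitrary points u (the Y_j with j in J) and v (the Y_j'
    with j' in J'):
      sum_I prod (X_i - v) prod (u - X_i') / prod (X_i - X_i')
        = prod (u - v).
    It is proved by induction on the number of points u.  As functions of one
    of these points, t, both sides are polynomials of degree at most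
    #J' < d, so it suffices to compare them at the d distinct points X_k.
    At t = X_k the factor t - X_k kills every summand with k outside I, and in
    the others the factors X_k - X_i' cancel against the denominator; what
    remains is prod (X_k - v) times the same identity without X_k and without
    t, which is the induction hypothesis.

    Distinctness modulo pi enters through the zeros of the complex sine
    [csin_eq0], which are used to see that the X_i are distinct and
    that the factors Y_j - Y_j' do not vanish. *)

(** * The rational identity *)

Lemma poly_eq_on_set (F : fieldType) (T : finType) (x : T -> F) (A : {set T})
    (p q : {poly F}) :
  {in A &, injective x} -> (size p <= #|A|)%N -> (size q <= #|A|)%N ->
  {in A, forall k, p.[x k] = q.[x k]} -> p = q.
Proof.
move=> x_inj szp szq pq; apply/eqP; rewrite -subr_eq0; apply/eqP.
apply: (@roots_geq_poly_eq0 _ _ [seq x k | k <- enum A]).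
- apply/allP=> z /mapP[k]; rewrite mem_enum => kA ->.
  by rewrite /root !hornerE pq // subrr.
- rewrite map_inj_in_uniq ?enum_uniq // => i j.
  by rewrite !mem_enum => iA jA /(x_inj i j iA jA).
- rewrite size_map -cardE (leq_trans (size_polyD _ _)) // size_polyN.
  by rewrite geq_max szp.
Qed.

(** Brings the summands that survive at the node x k into the shape of the
    induction hypothesis; I and k |: I determine each other since k is not
    in I. *)
Lemma reindex_set_containing (R : nmodType) (T : finType) (A : {set T})
    (k : T) (n : nat) (f : {set T} -> R) :
  k \in A ->
  \sum_(I : {set T} | (I \subset A) && (#|I| == n.+1) && (k \in I)) f I =
  \sum_(I : {set T} | (I \subset A :\ k) && (#|I| == n)) f (k |: I).
Proof.
move=> kA; rewrite (reindex_onto (fun I => k |: I) (fun I => I :\ k)) /=; last first.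
  by move=> I /andP[_ kI]; rewrite setD1K.
apply: eq_bigl => I; rewrite setU11 andbT subUset sub1set kA /= subsetD1.
have [kI|kI] := boolP (k \in I).
  rewrite andbF /=; apply/andP=> -[_ /eqP E].
  by move: kI; rewrite -E !inE eqxx.
by rewrite setU1K // eqxx cardsU1 kI !andbT.
Qed.

(** Interpolation in the first point of us at the nodes x k, k in A; the value
    at x k is the same identity for A minus k and the tail of us.  The points
    are kept in lists so that removing one of them is structural recursion. *)
Lemma sum_subsets_cross_prod (F : fieldType) (T : finType) (x : T -> F)
    (us vs : seq F) (A : {set T}) :
  {in A &, injective x} -> #|A| = (size us + size vs)%N ->
  \sum_(I : {set T} | (I \subset A) && (#|I| == size us))
    ((\prod_(i in I) \prod_(v <- vs) (x i - v)) *
     (\prod_(i' in A :\: I) \prod_(u <- us) (u - x i'))) /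
    (\prod_(i in I) \prod_(i' in A :\: I) (x i - x i')) =
  \prod_(u <- us) \prod_(v <- vs) (u - v).
Proof.
elim: us A => [|y us IH] A x_inj cardA.
  rewrite (big_pred1 set0) => [|I]; last first.
    by rewrite /= cards_eq0 andbC; case: eqP => // ->; rewrite sub0set.
  rewrite !big_set0 big_nil big1 => [|i _]; last by rewrite big_nil.
  by rewrite invr1 !mulr1.
(* p and q are the two sides with the first point y turned into 'X. *)
pose c (I : {set T}) := (\prod_(i in I) \prod_(v <- vs) (x i - v)) *
     (\prod_(i' in A :\: I) \prod_(u <- us) (u - x i')) /
    (\prod_(i in I) \prod_(i' in A :\: I) (x i - x i')).
pose p := \sum_(I : {set T} | (I \subset A) && (#|I| == (size us).+1))
  c I *: \prod_(i' in A :\: I) ('X - (x i')%:P).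
pose q := (\prod_(u <- us) \prod_(v <- vs) (u - v)) *:
  \prod_(v <- vs) ('X - v%:P).
have q_eval t : q.[t] = (\prod_(u <- us) \prod_(v <- vs) (u - v)) *
    \prod_(v <- vs) (t - v).
  by rewrite hornerZ horner_prod; congr (_ * _); apply: eq_bigr => v _; rewrite hornerXsubC.
have p_eval t : p.[t] = \sum_(I : {set T} | (I \subset A) && (#|I| == (size us).+1))
    c I * \prod_(i' in A :\: I) (t - x i').
  rewrite horner_sum; apply: eq_bigr => I _; rewrite hornerZ horner_prod.
  by congr (_ * _); apply: eq_bigr => i _; rewrite hornerXsubC.
have pq : p = q.
  apply: (poly_eq_on_set F T x A) => //.
  - apply: (leq_trans (size_sum _ _ _)); apply/bigmax_leqP => I /andP[IA /eqP cI].
    apply: (leq_trans (size_scale_leq _ _)).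
    rewrite -big_enum size_prod_XsubC -cardE cardsD (setIidPr IA) cI cardA /=.
    by rewrite addSn subSS addKn addnC -addSn leq_addr.
  - apply: (leq_trans (size_scale_leq _ _)).
    by rewrite size_prod_XsubC cardA /= addSn ltnS leq_addl.
  - move=> k kA; rewrite p_eval q_eval (bigID (fun I : {set T} => k \in I)) /=.
    (* If k is not in I, the factor of index k in the product over A minus I
       vanishes at x k. *)
    rewrite [X in _ + X]big1 ?addr0; last first.
      move=> I /andP[/andP[IA _] kI]; rewrite (bigD1 k) /=; last by rewrite inE kI kA.
      by rewrite subrr mul0r mulr0.
    rewrite reindex_set_containing // -(IH (A :\ k)); last first.
    + by move: cardA; rewrite (cardsD1 k) kA /= addSn => -[].
    + by move=> i j /setD1P[_ iA] /setD1P[_ jA]; apply: x_inj.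
    rewrite mulr_suml; apply: eq_bigr => I /andP[]; rewrite subsetD1 => /andP[IA kI] _.
    have -> : A :\ k :\: I = A :\: (k |: I) by rewrite setDDl.
    rewrite /c !big_setU1 //=.
    have nz : \prod_(i' in A :\: (k |: I)) (x k - x i') != 0.
      apply/prodf_neq0 => i; rewrite !inE negb_or => /andP[/andP[ik _] iA].
      by rewrite subr_eq0; apply: contra ik => /eqP /x_inj ->.
    rewrite invfM.
    move: (\prod_(i in I) \prod_(i' in _) (x i - x i'))^-1 => D.
    move: nz; move: (\prod_(i' in A :\: (k |: I)) (x k - x i')) => N N0.
    by field.
have := congr1 (horner^~ y) pq; rewrite /= p_eval q_eval big_cons mulrC => <-.
apply: eq_bigr => I _; rewrite /c -[RHS]mulrAC; congr (_ / _).
rewrite -[RHS]mulrA -big_split; congr (_ * _).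
by apply: eq_bigr => i _; rewrite big_cons mulrC.
Qed.

(** * The zeros of the complex sine *)

Lemma sin_intmul_pi (R : realType) (k : int) : sin (k%:~R * pi : R) = 0.
Proof.
have natP n : sin (n%:R * pi : R) = 0.
  elim: n => [|n IH]; first by rewrite mul0r sin0.
  by rewrite -natr1 mulrDl mul1r sinDpi IH oppr0.
by case: k => n; rewrite ?NegzE ?mulrNz ?mulNr ?sinN -pmulrn natP ?oppr0.
Qed.

(** Subtracting the multiple of pi given by the floor of u / pi moves u into
    [0, pi), where the sine vanishes only at 0. *)
Lemma sin_eq0_intmul_pi (R : realType) (u : R) :
  sin u = 0 -> exists k : int, u = k%:~R * pi.
Proof.
move=> su; exists (Num.floor (u / pi)); set k := Num.floor _.
have pi0 := pi_gt0 R.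
have : sin (u - k%:~R * pi) = 0 by rewrite sinB su sin_intmul_pi mul0r mulr0 subr0.
have r0 : 0 <= u - k%:~R * pi by rewrite subr_ge0 -ler_pdivlMr // floor_le.
have r1 : u - k%:~R * pi < pi.
  have := floorD1_gt (u / pi); rewrite -/k ltr_pdivrMr // intrD mulrDl mul1r; lra.
move: r0; rewrite le_eqVlt => /orP[/eqP/esym/eqP|r0 sr].
  by rewrite subr_eq0 => /eqP.
by have := @sin_gt0_pi R (u - k%:~R * pi); rewrite r0 r1 sr ltxx => /(_ isT).
Qed.

Lemma cexpD (R : realType) (z w : R[i]) : cexp (z + w) = cexp z * cexp w.
Proof.
case: z w => [a b] [c e]; apply/eqP; rewrite eq_complex /cexp /= expRD cosD sinD.
by apply/andP; split; apply/eqP; ring.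
Qed.

Lemma cexp0 (R : realType) : cexp (0 : R[i]) = 1.
Proof. by apply/eqP; rewrite eq_complex /cexp /= expR0 cos0 sin0; apply/andP; split; apply/eqP; ring. Qed.

Lemma cexp_neq0 (R : realType) (z : R[i]) : cexp z != 0.
Proof.
apply/eqP=> z0; have := cexpD R z (- z); rewrite subrr cexp0 z0 mul0r.
by move/eqP; rewrite oner_eq0.
Qed.


(** For z = a + ib, a zero of the sine means exp(iz) = exp(-iz), that is
    exp(-b) cos a = exp(b) cos a and exp(-b) sin a = - exp(b) sin a.  The second
    equation forces sin a = 0; then cos a is nonzero and the first gives
    b = 0. *)
Lemma csin_eq0 (R : realType) (z : R[i]) : csin z = 0 -> eq_mod_pi z 0.
Proof.
have i2 : (2 * (0 +i* 1) : R[i]) != 0.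
  by rewrite mulf_neq0 ?pnatr_eq0 // eq_complex /= oner_eq0 andbF.
move=> /eqP; rewrite mulf_eq0 invr_eq0 (negPf i2) orbF subr_eq0.
case: z => a b; rewrite /cexp eq_complex /= !(mul0r, mul1r, add0r, addr0, subr0).
rewrite cosN sinN opprK => /andP[/eqP ec /eqP es].
have := expR_gt0 b; have := expR_gt0 (- b); have := cos2Dsin2 a.
move: (@expR_inj R (- b) b) ec es.
set B := expR (- b); set B' := expR b; set s := sin a; set c := cos a.
move=> inj ec es cs B0 B'0.
have s0 : sin a = 0.
  have /eqP : (B + B') * s = 0 by rewrite mulrDl es; ring.
  by rewrite mulf_eq0 gt_eqF ?addr_gt0 // => /eqP.
have c0 : c != 0.
  by apply/eqP=> c0; move: cs; rewrite /s s0 c0 expr0n addr0 => /eqP; rewrite eq_sym oner_eq0.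
have b0 : b = 0 by have := inj (mulIf c0 ec); lra.
have [k ak] := sin_eq0_intmul_pi R a s0.
exists k; rewrite subr0 b0 ak.
by rewrite -(rmorph_int (real_complex R)) -rmorphM.
Qed.

(** * From sines to differences *)

Lemma csin_sub (R : realType) (x y : R[i]) :
  csin (x - y) = (2 * (0 +i* 1))^-1 * (cexp ((0 +i* 1) * x))^-1 *
    (cexp ((0 +i* 1) * y))^-1 *
    (cexp ((0 +i* 1) * x) ^+ 2 - cexp ((0 +i* 1) * y) ^+ 2).
Proof.
have cexpN (z : R[i]) : cexp (- z) = (cexp z)^-1.
  apply: (mulfI (cexp_neq0 R z)).
  by rewrite -cexpD subrr cexp0 divff // cexp_neq0.
rewrite /csin mulrBr opprB !cexpD !cexpN.
move: (cexp_neq0 R ((0 +i* 1) * y)) (cexp_neq0 R ((0 +i* 1) * x)).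
move: (cexp _) (cexp _) => X Y Y0 X0.
have -> : X / Y - Y / X = X^-1 / Y * (X ^+ 2 - Y ^+ 2) by field; rewrite X0 Y0.
by rewrite [LHS]mulrC !mulrA.
Qed.

(** The prefactors of a product over A x B depend on A and B only through
    their cardinalities and their total products; this makes the prefactors of
    numerator and denominator comparable. *)
Lemma prod_cross_scale (F : fieldType) (S T : finType) (A : {set S})
    (B : {set T}) (s : F) (f : S -> F) (g : T -> F) (h : S -> T -> F) :
  \prod_(i in A) \prod_(j in B) (s * f i * g j * h i j) =
  s ^+ (#|A| * #|B|) * (\prod_(i in A) f i) ^+ #|B| *
    (\prod_(j in B) g j) ^+ #|A| * \prod_(i in A) \prod_(j in B) h i j.
Proof.
under eq_bigr do rewrite !big_split !prodr_const /=.
by rewrite !big_split /= !prodr_const -exprM -!prodrXl mulnC.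
Qed.

Theorem corollary3 (R : realType) (d m : nat) (hd : (2 <= d)%N) (hm : (m <= d)%N)
    (a b : 'I_d -> R[i])
    (hab : pairwise_distinct_mod_pi (joint_family a b))
    (J : {set 'I_d}) (hJ : #|J| = m) :
  \sum_(I : {set 'I_d} | #|I| == m)
     ((\prod_(i in I) \prod_(j' in ~: J) csin (a i - b j')) *
      (\prod_(i' in ~: I) \prod_(j in J) csin (b j - a i'))) /
     ((\prod_(i in I) \prod_(i' in ~: I) csin (a i - a i')) *
      (\prod_(j in J) \prod_(j' in ~: J) csin (b j - b j'))) = 1.
Proof.
pose e (z : R[i]) := cexp ((0 +i* 1) * z).
pose s : R[i] := (2 * (0 +i* 1))^-1.
have e0 z : e z != 0 by apply: cexp_neq0.
have s0 : s != 0.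
  by rewrite invr_neq0 // mulf_neq0 ?pnatr_eq0 // eq_complex /= oner_eq0 andbF.
have csinE x y : csin (x - y) = s * (e x)^-1 * (e y)^-1 * (e x ^+ 2 - e y ^+ 2).
  exact: csin_sub.
have e2_inj x y : e x ^+ 2 = e y ^+ 2 -> eq_mod_pi x y.
  move=> exy; have /csin_eq0[k] : csin (x - y) = 0.
    by rewrite csinE exy subrr mulr0.
  by rewrite subr0; exists k.
pose X i := e (a i) ^+ 2; pose Y j := e (b j) ^+ 2.
have X_inj : injective X.
  move=> i j /e2_inj; have [//|/eqP ij] := eqVneq i j.
  by case/(hab (inl i) (inl j)) => -[].
have DJ0 : \prod_(j in J) \prod_(j' in ~: J) (Y j - Y j') != 0.
  apply/prodf_neq0 => j jJ; apply/prodf_neq0 => j'; rewrite inE => j'J.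
  rewrite subr_eq0; apply/eqP => /e2_inj.
  by case/(hab (inr j) (inr j')) => -[jj']; rewrite -jj' jJ in j'J.
have := @sum_subsets_cross_prod _ _ X [seq Y j | j in J] [seq Y j | j in ~: J]
  setT (in2W X_inj).
rewrite !size_map -!cardE cardsC cardsT hJ => /(_ erefl).
rewrite big_image; under [RHS]eq_bigr do rewrite big_image.
move=> main; rewrite -[RHS](divff DJ0) -{1}main mulr_suml.
apply: eq_big => [I|I /eqP cI]; first by rewrite subsetT.
rewrite setTD.
have cI' : #|~: I| = #|~: J|.
  by apply/eqP; rewrite -(eqn_add2l m) -{1}cI -hJ !cardsC.
under [X in _ = X * _ / _ / _]eq_bigr do rewrite big_image.
under [X in _ = _ * X / _ / _]eq_bigr do rewrite big_image.
(* K is the common prefactor of the numerator and the denominator. *)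
pose w (z : R[i]) := (e z)^-1.
pose K := s ^+ (m * #|~: J|) * s ^+ (m * #|~: J|) *
  (\prod_(i in I) w (a i)) ^+ #|~: J| * (\prod_(i in ~: I) w (a i)) ^+ m *
  (\prod_(j in J) w (b j)) ^+ #|~: J| * (\prod_(j in ~: J) w (b j)) ^+ m.
have K0 : K != 0.
  by rewrite !mulf_neq0 // expf_neq0 //; apply/prodf_neq0 => i _; rewrite invr_neq0.
have -> : (\prod_(i in I) \prod_(j' in ~: J) csin (a i - b j')) *
    (\prod_(i' in ~: I) \prod_(j in J) csin (b j - a i')) =
  K * ((\prod_(i in I) \prod_(j' in ~: J) (X i - Y j')) *
    (\prod_(i' in ~: I) \prod_(j in J) (Y j - X i'))).
  under eq_bigr do under eq_bigr do rewrite csinE.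
  under [X in _ * X = _]eq_bigr do under eq_bigr do rewrite csinE (mulrAC s).
  by rewrite !prod_cross_scale cI' cI hJ /K (mulnC _ m); ring.
have -> : (\prod_(i in I) \prod_(i' in ~: I) csin (a i - a i')) *
    (\prod_(j in J) \prod_(j' in ~: J) csin (b j - b j')) =
  K * ((\prod_(i in I) \prod_(i' in ~: I) (X i - X i')) *
    (\prod_(j in J) \prod_(j' in ~: J) (Y j - Y j'))).
  under eq_bigr do under eq_bigr do rewrite csinE.
  under [X in _ * X = _]eq_bigr do under eq_bigr do rewrite csinE.
  by rewrite !prod_cross_scale cI' cI hJ /K; ring.
by rewrite -mulf_div divff // mul1r invfM mulrA.
Qed.
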